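(* Let $x^{\ast}\in\mathbb{R}^2$ be a solution of the weighted Weber problem, i.e. $\sum_{j=2}^J\rho_j d_j(x^{\ast})=\min_{x\in\mathbb{R}^2}\sum_{j=2}^J\rho_j d_j(x)$. Then for every $N\geq 1$ the point $x^{\ast}$ also maximizes the total warehouse throughput: $TH_w(N;x^{\ast})=\max_{x\in\mathbb{R}^2}TH_w(N;x)$.
   Context: Data: an integer $J\ge 2$; warehouses $j=2,\dots,J$ with locations $a_j\in\mathbb{R}^2$ and demands $D_j>0$; $D=\sum_{j=2}^J D_j$, $\rho_j=D_j/D$ (so $\sum_{j=2}^J\rho_j=1$); a convex function $d:\mathbb{R}^2\times\mathbb{R}^2\to[0,\infty)$, and $d_j(x):=d(a_j,x)$; for $j=1,\dots,J$ an integer $s_j\ge 1$ and a real $\mu_j>0$, with $\mu_j(n):=\mu_j\min(n,s_j)$, $n\in\mathbb{N}$. Node $1$ is the production center, located at $x\in\mathbb{R}^2$. Network: for $N\ge1$ and $x\in\mathbb{R}^2$, $N$ trucks circulate in a closed queueing network (Gordon–Newell network) with node set $\bar J=\{1,2,\dots,J,2a,\dots,Ja,2b,\dots,Jb\}$. Node $j\in\{1,\dots,J\}$ is a first-come-first-served exponential station with total service rate $\mu_j(n_j)$ when $n_j$ trucks are present. Nodes $ja$ and $jb$ ($j=2,\dots,J$) are infinite-server stations with exponential service times (travel times) of mean $d_j(x)$, i.e. total rates $\mu_{ja}(x)(n)=\mu_{jb}(x)(n)=n/d_j(x)$. All service times and routing decisions are independent. Routing: $r(1,ja)=\rho_j$,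 $r(ja,j)=r(j,jb)=r(jb,1)=1$ for $j=2,\dots,J$, all other $r(k,m)=0$. Thus the queue length vector is a continuous-time Markov chain on $S(N,\bar J)=\{(n_i)_{i\in\bar J}\in\mathbb{N}^{\bar J}:\sum_i n_i=N\}$ which jumps from $n$ to $n-e_i+e_k$ (for $n_i\ge1$) at rate (total service rate of node $i$ at $n_i$) $\cdot\, r(i,k)$. Let $\pi(\cdot;x)$ be its unique stationary distribution. (If $d_j(x)=0$, travel on $ja,jb$ is instantaneous, and $n_{ja}=n_{jb}=0$ always.) Throughput: for $j=2,\dots,J$, $TH_j(N;x)=\sum_{n\in S(N,\bar J)}\pi(n;x)\mu_j(n_j)$ is the stationary mean number of truck departures per time unit from warehouse $j$ (equal to the long-run number of truck loads unloaded at $j$ per unit time), and $TH_w(N;x)=\sum_{j=2}^J TH_j(N;x)$. *)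

(* Defs.v *)
From HB Require Import structures.
From mathcomp Require Import all_boot all_order all_algebra.
From mathcomp Require Import all_classical all_reals all_analysis.

Set Implicit Arguments.
Unset Strict Implicit.
Unset Printing Implicit Defensive.

Import Order.TTheory GRing.Theory Num.Theory.

Local Open Scope ring_scope.

Definition plane (R : realType) : Type := 'rV[R]_2.

(* The J - 1 warehouses 2, ..., J: [w : 'I_J.-1] stands for
   warehouse w + 2. *)
Definition warehouse (J : nat) : Type := 'I_J.-1.

(* The FCFS stations 1, ..., J: [None] is the production center (node 1) and
   [Some w] is the warehouse w. *)
Definition station (J : nat) : Type := option 'I_J.-1.

(* [Outbound w] is node ja (production center to warehouse), [Inbound w] is
   node jb (warehouse back to production center). *)
Inductive node (J : nat) : Type :=
  | Station of station J
  | Outbound of warehouse J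
  | Inbound of warehouse J.

Arguments Station {J}.
Arguments Outbound {J}.
Arguments Inbound {J}.

Section NodeFinite.
Variable J : nat.

Definition node_code (i : node J) : option 'I_J.-1 + ('I_J.-1 + 'I_J.-1) :=
  match i with
  | Station k => inl k
  | Outbound w => inr (inl w)
  | Inbound w => inr (inr w)
  end.

Definition node_decode (c : option 'I_J.-1 + ('I_J.-1 + 'I_J.-1)) : node J :=
  match c with
  | inl k => Station k
  | inr (inl w) => Outbound w
  | inr (inr w) => Inbound w
  end.

Lemma node_codeK : cancel node_code node_decode.
Proof. by case. Qed.

HB.instance Definition _ := Equality.copy (node J) (can_type node_codeK).
HB.instance Definition _ := Choice.copy (node J) (can_type node_codeK).
HB.instance Definition _ := Countable.copy (node J) (can_type node_codeK).
HB.instance Definition _ := Finite.copy (node J) (can_type node_codeK).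

End NodeFinite.

Record network (R : realType) (J : nat) := Network {
  location : warehouse J -> plane R;
  demand : warehouse J -> R;
  dist : plane R * plane R -> R;
  servers : station J -> nat;
  rate : station J -> R }.

(* S(N, \bar J) *)
Definition state (J N : nat) : Type :=
  {n : {ffun node J -> 'I_N.+1} | (\sum_i n i)%N == N}.

Definition queue (J N : nat) (n : state J N) (i : node J) : nat := val n i.

Section Model.
Variables (R : realType) (J : nat) (M : network R J).

Definition total_demand : R := \sum_(w < J.-1) demand M w.

Definition weight (w : warehouse J) : R := demand M w / total_demand.

Definition wdist (w : warehouse J) (x : plane R) : R := dist M (location M w, x).

Definition weber (x : plane R) : R := \sum_(w < J.-1) weight w * wdist w x.

Definition weber_solution (x : plane R) : Prop := forall y, weber x <= weber y.

Definition station_rate (k : station J) (n : nat) : R :=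
  rate M k * (minn n (servers M k))%:R.

Definition service_rate (x : plane R) (i : node J) (n : nat) : R :=
  match i with
  | Station k => station_rate k n
  | Outbound w | Inbound w => n%:R / wdist w x
  end.

Definition routing (i k : node J) : R :=
  match i, k with
  | Station None, Outbound w => weight w
  | Outbound w, Station (Some v) => (w == v)%:R
  | Station (Some w), Inbound v => (w == v)%:R
  | Inbound _, Station None => 1
  | _, _ => 0
  end.

(* A truck routed to a travel node of zero mean travel time is at once at the
   end of that journey. *)
Definition settle (x : plane R) (k : node J) : node J :=
  match k with
  | Outbound w => if wdist w x == 0 then Station (Some w) else k
  | Inbound w => if wdist w x == 0 then Station None else k
  | Station _ => k
  end.

(* This is [routing i k] when all the distances at x are nonzero. *)
Definition settled_routing (x : plane R) (i k : node J) : R :=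
  \sum_(m | settle x m == k) routing i m.

Section Chain.
Variables (N : nat) (x : plane R).

(* m = n - e_i + e_k, where n_i >= 1 *)
Definition jump (i k : node J) (n m : state J N) : bool :=
  (0 < queue n i)%N &&
  [forall l, queue m l == (queue n l - (l == i) + (l == k))%N].

Definition transition_rate (n m : state J N) : R :=
  \sum_i \sum_(k | jump i k n m)
     service_rate x i (queue n i) * settled_routing x i k.

(* Travel nodes of zero mean travel time are always empty. *)
Definition admissible (n : state J N) : Prop :=
  forall w, wdist w x = 0 ->
    queue n (Outbound w) = 0%N /\ queue n (Inbound w) = 0%N.

Definition stationary (p : {ffun state J N -> R}) : Prop :=
  [/\ forall n, 0 <= p n,
      \sum_n p n = 1,
      forall n, ~ admissible n -> p n = 0 &
      forall n, admissible n ->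
        \sum_m p m * transition_rate m n = p n * \sum_m transition_rate n m].

(* The chain is irreducible on the finite set of admissible states as soon as
   the demands, the service rates and the numbers of servers are positive and
   the distances nonnegative, so exactly one p is [stationary] and the default
   value 0 is then irrelevant. *)
Definition stationary_distribution : {ffun state J N -> R} :=
  xget [ffun=> 0] [set p | stationary p]%classic.

Definition throughput (w : warehouse J) : R :=
  \sum_n stationary_distribution n *
         station_rate (Some w) (queue n (Station (Some w))).

Definition warehouse_throughput : R := \sum_(w < J.-1) throughput w.

End Chain.
End Model.

(* Main.v *)
Require Import Defs.
From HB Require Import structures.
From mathcomp Require Import all_boot all_order all_algebra.
From mathcomp Require Import all_classical all_reals all_analysis.
From mathcomp Require Import ring lra zify.

Set Implicit Arguments.
Unset Strict Implicit.
Unset Printing Implicit Defensive.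

Import Order.TTheory GRing.Theory Num.Theory.

Local Open Scope ring_scope.

(* The chain has a product-form equilibrium, so the total warehouse throughput
   is G_(N-1) / G_N, where G_k is the coefficient of degree k of the product over
   the nodes of the generating functions of their weights.  A travel node with
   load a contributes the exponential series of a t, so x enters only through
   the factor exp (2 W(x) t), W being the Weber objective.  All the series have
   log-concave coefficients, hence so has their product; and multiplying a
   log-concave series G by exp (b t), b >= 0, can only decrease G_(N-1) / G_N. *)

(** * Log-concave polynomials *)

Section Coefficients.
Variable R : realFieldType.
Implicit Types (p q : {poly R}) (a b : R).

(** Congruence modulo degree n + 1. With N trucks only coefficients up to degree N count, so
    truncated polynomials can stand for power series. *)
Definition eq_upto (n : nat) (p q : {poly R}) : Prop :=
  forall k, (k <= n)%N -> p`_k = q`_k.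

Lemma eq_uptoM n p p' q q' :
  eq_upto n p p' -> eq_upto n q q' -> eq_upto n (p * q) (p' * q').
Proof.
move=> pp' qq' k le_kn; rewrite !coefM; apply: eq_bigr => i _.
by rewrite pp' ?qq' //; have := ltn_ord i; lia.
Qed.

(* [(p * 'X^s)`_r] is the entry (r, s) of the lower triangular Toeplitz matrix
   of the coefficients of p, so the condition says that the 2 x 2 minors of this
   matrix are nonnegative. *)
Definition log_concave (p : {poly R}) : Prop :=
  forall r1 r2 s1 s2, (r1 <= r2)%N -> (s1 <= s2)%N ->
    (p * 'X^s2)`_r1 * (p * 'X^s1)`_r2 <= (p * 'X^s1)`_r1 * (p * 'X^s2)`_r2.

Lemma log_concave1 : log_concave 1.
Proof.
move=> r1 r2 s1 s2 le_r le_s; rewrite !mul1r !coefXn -!natrM ler_nat.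
by do !case: eqP => /=; lia.
Qed.

(* The Toeplitz matrix of p * q is the product of those of p and q, so this is
   the Cauchy-Binet formula for 2 x 2 minors. *)
Lemma log_concaveM p q : log_concave p -> log_concave q -> log_concave (p * q).
Proof.
move=> lc_p lc_q r1 r2 s1 s2 le_r le_s.
pose K := maxn (size (q * 'X^s1)%R) (size (q * 'X^s2)%R).
pose A r k := (p * 'X^k)`_r; pose B k s := (q * 'X^s)`_k.
have AB r s : (size (q * 'X^s)%R <= K)%N ->
    (p * q * 'X^s)`_r = \sum_(k < K) A r k * B k s.
  move=> le_K; rewrite -mulrA -[in LHS](coefK (q * 'X^s)) poly_def mulr_sumr.
  rewrite coef_sum -(big_mkord xpredT (fun k => (p * (_`_k *: 'X^k))`_r)).
  rewrite (big_nat_widen _ _ K) // big_mkcond big_mkord.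
  apply: eq_bigr => k _; rewrite -scalerAr coefZ /A /B [RHS]mulrC.
  by case: ltnP => //= le_k; rewrite [(q * _)`_k]nth_default ?mul0r.
rewrite -/A !AB ?leq_maxl ?leq_maxr //.
rewrite -subr_ge0.
have prodE r r' s s' :
    (\sum_(k < K) A r k * B k s) * (\sum_(k < K) A r' k * B k s')
    = \sum_(k < K) \sum_(l < K) A r k * B k s * (A r' l * B l s').
  by rewrite mulr_suml; apply: eq_bigr => k _; rewrite mulr_sumr.
set D := (X in 0 <= X).
have D1 : D = \sum_(k < K) \sum_(l < K)
    A r1 k * A r2 l * (B k s1 * B l s2 - B k s2 * B l s1).
  rewrite /D !prodE -sumrB; apply: eq_bigr => k _; rewrite -sumrB.
  by apply: eq_bigr => l _; ring.
have D2 : D = \sum_(k < K) \sum_(l < K)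
    A r1 l * A r2 k * (B l s1 * B k s2 - B l s2 * B k s1).
  by rewrite D1 exchange_big.
(* Adding the two forms of [D] pairs the terms (k, l) and (l, k): each summand becomes a minor of
   [A] times a minor of [B], and both minors change sign together with k - l. *)
suff : 0 <= D + D by lra.
rewrite {1}D1 {1}D2 -big_split sumr_ge0 // => k _.
rewrite -big_split sumr_ge0 // => l _ /=.
have -> : A r1 k * A r2 l * (B k s1 * B l s2 - B k s2 * B l s1) +
    A r1 l * A r2 k * (B l s1 * B k s2 - B l s2 * B k s1) =
    (A r1 k * A r2 l - A r1 l * A r2 k) * (B k s1 * B l s2 - B k s2 * B l s1).
  by ring.
have [le_kl | /ltnW le_lk] := leqP k l.
  by rewrite mulr_ge0 // subr_ge0 ?lc_p ?lc_q.
rewrite mulr_le0 // subr_le0 ?lc_p //.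
by rewrite mulrC [X in _ <= X]mulrC lc_q.
Qed.

Lemma log_concave_prod (I : finType) (P : I -> {poly R}) :
  (forall i, log_concave (P i)) -> log_concave (\prod_i P i).
Proof.
move=> lc_P; apply: (big_ind log_concave) => //; first exact: log_concave1.
exact: log_concaveM.
Qed.

(** The [g k] are the ratios of consecutive coefficients. Prescribing ratios instead of dividing
    coefficients admits vanishing ones, as in the exponential of 0. *)
Lemma log_concave_poly (g : nat -> R) K :
  (forall k, 0 <= g k) -> (forall k l, (k <= l)%N -> g l <= g k) ->
  log_concave (\poly_(n < K) \prod_(k < n) g k).
Proof.
move=> g_ge0 g_anti r1 r2 s1 s2 le_r le_s.
pose f n := \prod_(k < n) g k.
have f_ge0 n : 0 <= f n by apply: prodr_ge0.
have fD m n : f (m + n)%N = f m * \prod_(k < n) g (m + k)%N by rewrite /f big_split_ord.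
rewrite !coefMXn !coef_poly -/(f _) -/(f _) -/(f _) -/(f _).
have rhs_ge0 :
    0 <= (if (r1 < s1)%N then 0 else if (r1 - s1 < K)%N then f (r1 - s1)%N else 0) *
         (if (r2 < s2)%N then 0 else if (r2 - s2 < K)%N then f (r2 - s2)%N else 0).
  by rewrite mulr_ge0 //; do 2![case: ifP => //].
(* The left side carries the smallest and the largest of the four indices; if both lie in [0, K), so
   do the two on the right. *)
have [lt1|le1] := ltnP r1 s2; first by rewrite mul0r.
have [lt2|le2] := ltnP r2 s1; first by rewrite mulr0.
have [lt3|le3] := ltnP (r1 - s2) K; last by rewrite mul0r.
have [lt4|le4] := ltnP (r2 - s1) K; last by rewrite mulr0.
have -> : (r1 < s1)%N = false by lia.
have -> : (r2 < s2)%N = false by lia.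
have -> : (r1 - s1 < K)%N by lia.
have -> : (r2 - s2 < K)%N by lia.
have -> : (r2 - s1 = (r2 - s2) + (s2 - s1))%N by lia.
have -> : (r1 - s1 = (r1 - s2) + (s2 - s1))%N by lia.
(* After cancelling common factors, s2 - s1 consecutive ratios starting at r2 - s2 are compared with
   as many starting at the smaller index r1 - s2. *)
rewrite !fD mulrA [X in _ <= X]mulrAC ler_wpM2l ?mulr_ge0 //.
by apply: ler_prod => k _; rewrite g_ge0 g_anti //; lia.
Qed.

(** The first K terms of exp(a t), written through coefficient ratios to match [log_concave_poly]
    and the weights of infinite-server nodes. *)
Definition expansion (K : nat) (a : R) : {poly R} :=
  \poly_(n < K) \prod_(k < n) (a / k.+1%:R).

Lemma expansion_coef a n : \prod_(k < n) (a / k.+1%:R) = a ^+ n / n`!%:R.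
Proof.
elim: n => [|n IH]; first by rewrite big_ord0 expr0 fact0 divr1.
by rewrite big_ord_recr /= IH exprSr factS natrM invfM mulrACA [n`!%:R^-1 * _]mulrC.
Qed.

Lemma expansion_nneg K a : 0 <= a -> expansion K a \is a polyOver Num.nneg.
Proof.
move=> a_ge0; apply: polyOver_poly => n _; apply: rpred_prod => k _.
by rewrite nnegrE divr_ge0.
Qed.

(** The binomial theorem; truncation spoils the exponential law only above degree n. *)
Lemma expansionD n a b :
  eq_upto n (expansion n.+1 a * expansion n.+1 b) (expansion n.+1 (a + b)).
Proof.
move=> m le_mn; rewrite coefM coef_poly ltnS le_mn expansion_coef addrC exprDn.
rewrite mulr_suml; apply: eq_bigr => i _.
have le_im : (i <= m)%N by rewrite -ltnS.
rewrite !coef_poly !ltnS (leq_trans le_im le_mn) (leq_trans (leq_subr i m) le_mn).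
rewrite !expansion_coef -mulr_natr -(bin_fact le_im) !natrM !invfM.
have bin_neq0 : 'C(m, i)%:R != 0 :> R by rewrite pnatr_eq0 -lt0n bin_gt0.
have fi : i`!%:R != 0 :> R by rewrite pnatr_eq0 -lt0n fact_gt0.
have fmi : (m - i)`!%:R != 0 :> R by rewrite pnatr_eq0 -lt0n fact_gt0.
by field; rewrite fi fmi bin_neq0.
Qed.

Lemma expansion_sum n (I : finType) (a : I -> R) :
  eq_upto n (\prod_i expansion n.+1 (a i)) (expansion n.+1 (\sum_i a i)).
Proof.
apply: (@big_ind2 _ _ (fun p c => eq_upto n p (expansion n.+1 c)) 1 *%R 0 +%R)
    => //.
  move=> k le_kn; rewrite coef1 coef_poly ltnS le_kn expansion_coef expr0n.
  by case: k le_kn => [|k]; rewrite ?fact0 ?divr1 ?mul0r.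
move=> p c q e pc qe k le_kn; rewrite -expansionD //.
exact: (eq_uptoM pc qe).
Qed.

Lemma log_concave_expansion K a : 0 <= a -> log_concave (expansion K a).
Proof.
move=> a_ge0; apply: (@log_concave_poly (fun k => a / k.+1%:R)) => [k|k l le_kl].
  by rewrite divr_ge0.
by rewrite ler_wpM2l // lef_pV2 ?posrE ?ltr0n // ler_nat ltnS.
Qed.

(* Log-concavity makes p_(k-1) / p_k nondecreasing in k; the ratio for q * p is
   an average of the ratios of index at most n + 1. *)
Lemma coef_ratio_mul p q n : log_concave p ->
    p \is a polyOver Num.nneg -> q \is a polyOver Num.nneg ->
  (q * p)`_n * p`_n.+1 <= p`_n * (q * p)`_n.+1.
Proof.
move=> lc_p /polyOverP p_ge0 /polyOverP q_ge0.
(* The right side has one more term, from the coefficient of index n + 1 of q; it is nonnegative and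
   is dropped. The others are compared one by one. *)
rewrite !coefM mulr_suml mulr_sumr [X in _ <= X]big_ord_recr /=.
rewrite -[X in X <= _]addr0 lerD ?mulr_ge0 //; try exact: p_ge0; try exact: q_ge0.
apply: ler_sum => k _; rewrite mulrCA -mulrA ler_wpM2l //; first exact: q_ge0.
(* Rows n and n + 1, columns 0 and k, of the Toeplitz matrix of p. *)
have := lc_p n n.+1 0%N k (leqnSn n) (leq0n k).
rewrite expr0 mulr1 !coefMXn.
have -> : (n < k)%N = false by have := ltn_ord k; lia.
by have -> : (n.+1 < k)%N = false by have := ltn_ord k; lia.
Qed.

End Coefficients.

(** * States and jumps *)

Lemma big_option (T : Type) (idx : T) (op : Monoid.com_law idx) (I : finType)
    (F : option I -> T) :
  \big[op/idx]_k F k = op (F None) (\big[op/idx]_i F (Some i)).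
Proof.
rewrite (bigD1 None) //=; congr (op _ _).
rewrite (reindex_omap (op := op) Some id) => [|[]] //=.
by apply: eq_bigl => i; rewrite eqxx.
Qed.

Lemma big_node (T : Type) (idx : T) (op : Monoid.com_law idx) (J : nat)
    (F : node J -> T) :
  \big[op/idx]_i F i =
    op (op (F (Station None)) (\big[op/idx]_w F (Station (Some w))))
       (op (\big[op/idx]_w F (Outbound w)) (\big[op/idx]_w F (Inbound w))).
Proof.
rewrite (reindex (@node_decode J)) /=; last first.
  by exists (@node_code J) => [[k|[w|w]]|[k|w|w]].
by rewrite !big_sumType /= big_option.
Qed.

Section States.
Variables J N : nat.
Implicit Types (n m : state J N) (i k l : node J).

Lemma sum_queue n : (\sum_i queue n i)%N = N.
Proof. exact: (eqP (valP n)). Qed.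

Lemma queue_inj n m : queue n =1 queue m -> n = m.
Proof. by move=> nm; apply/val_inj/ffunP => i; apply/val_inj/nm. Qed.

Lemma state_of (g : node J -> nat) :
  (\sum_i g i)%N = N -> exists n : state J N, queue n =1 g.
Proof.
move=> gN; have le_gN i : (g i < N.+1)%N.
  by rewrite ltnS -gN (bigD1 i) //= leq_addr.
pose h := [ffun i => Ordinal (le_gN i)].
have hN : (\sum_i h i)%N == N.
  by rewrite -[X in _ == X]gN; apply/eqP/eq_bigr => i _; rewrite ffunE.
by exists (exist _ h hN) => i; rewrite /queue /= ffunE.
Qed.

Lemma jumpP i k n m :
  reflect ((0 < queue n i)%N /\
           forall l, queue m l = (queue n l - (l == i) + (l == k))%N)
          (jump i k n m).
Proof.
apply: (iffP andP) => -[n_gt0 nm]; split=> //.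
  by move=> l; exact/eqP/(forallP nm).
by apply/forallP => l; apply/eqP.
Qed.

Lemma jump_sym i k n m : jump i k n m -> jump k i m n.
Proof.
case/jumpP => n_gt0 nm; apply/jumpP; split=> [|l].
  by rewrite nm eqxx addn1.
rewrite nm addnK; case: (eqVneq l i) => [->|_]; first by rewrite subnK.
by rewrite subn0 addn0.
Qed.

Lemma jumpC i k n m : jump i k n m = jump k i m n.
Proof. by apply/idP/idP; exact: jump_sym. Qed.

Lemma jump_ex i k n : (0 < queue n i)%N -> exists m, jump i k n m.
Proof.
move=> n_gt0.
have [|m nm] := @state_of (fun l => (queue n l - (l == i) + (l == k))%N).
  have sum1 (j : node J) : (\sum_l (l == j))%N = 1%N.
    by rewrite (bigD1 j) //= eqxx big1 // => l /negPf ->.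
  rewrite big_split /= sum1 -[X in (_ + X)%N](sum1 i) -big_split /= -[RHS](sum_queue n).
  by apply: eq_bigr => l _; case: eqP => [->|_]; rewrite ?subnK ?subn0 ?addn0.
by exists m; apply/jumpP.
Qed.

(** The nodes i, k and the state n determine the target of a jump, so the sum has at most one
    term. *)
Lemma sum_jump (R : pzRingType) i k n (F : state J N -> R) (c : R) :
  (forall m, jump i k n m -> F m = c) ->
  \sum_(m | jump i k n m) F m = if (0 < queue n i)%N then c else 0.
Proof.
move=> Fc; case: ifPn => [n_gt0|/negPf n_eq0]; last first.
  by rewrite big_pred0 // => m; rewrite /jump n_eq0.
have [m nm] := jump_ex k n_gt0; rewrite (big_pred1 m) ?Fc // => m'.
apply/idP/eqP => [nm'|->//]; apply: queue_inj => l.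
by have [_ ->] := jumpP _ _ _ _ nm; have [_ ->] := jumpP _ _ _ _ nm'.
Qed.

(** Distributing the product over all assignments of queue lengths, the coefficient of degree N
    selects those with N trucks in total, which are the states. *)
Lemma sum_prod_queue (R : comNzRingType) (g : node J -> nat -> R) :
  \sum_(n : state J N) \prod_i g i (queue n i) =
  (\prod_i \poly_(k < N.+1) g i k)`_N.
Proof.
under [in RHS]eq_bigr do rewrite poly_def.
rewrite bigA_distr_bigA coef_sum /=.
under [in RHS]eq_bigr => f _.
  rewrite scaler_prod prodrXr coefZ coefXn.
  over.
rewrite (bigID (fun f : {ffun node J -> 'I_N.+1} => (\sum_i f i)%N == N)) /=.
rewrite [X in _ = _ + X]big1 => [|f /negPf]; last first.
  by rewrite eq_sym => ->; rewrite mulr0.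
rewrite addr0 (@reindex_omap _ _ _ _ (state J N) val insub) /=; last first.
  by move=> f fN; rewrite insubT.
apply: eq_big => [n|n _].
  by rewrite valK eqxx andbT (valP n).
by rewrite eq_sym (valP n) mulr1.
Qed.

End States.

(** * Product-form equilibrium *)

Section Equilibrium.
Variables (R : realType) (J : nat) (M : network R J) (x : plane R).
Hypotheses (J_ge2 : (2 <= J)%N) (demand_gt0 : forall w, 0 < demand M w)
  (dist_ge0 : forall z, 0 <= dist M z)
  (servers_ge1 : forall k, (1 <= servers M k)%N)
  (rate_gt0 : forall k, 0 < rate M k).

Lemma total_demand_gt0 : 0 < total_demand M.
Proof.
have lt0 : (0 < J.-1)%N by lia.
rewrite /total_demand (bigD1 (Ordinal lt0)) //= ltr_pwDl ?sumr_ge0 // => w _.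
exact: ltW.
Qed.

Lemma weight_gt0 w : 0 < weight M w.
Proof. by rewrite divr_gt0 ?total_demand_gt0. Qed.

Lemma sum_weight : \sum_w weight M w = 1.
Proof. by rewrite -mulr_suml mulfV // gt_eqF ?total_demand_gt0. Qed.

(** The solution of the traffic equations normalised to 1 at the production center. A travel node of
    zero travel time is bypassed by the settled routing, hence the value 0. *)
Definition visit (i : node J) : R :=
  match i with
  | Station None => 1
  | Station (Some w) => weight M w
  | Outbound w | Inbound w => if wdist M w x == 0 then 0 else weight M w
  end.

Lemma visit_ge0 i : 0 <= visit i.
Proof. by case: i => [[w|]|w|w] //=; try case: ifP => // _; exact/ltW/weight_gt0. Qed.

Lemma sum_settled_routing i : \sum_k settled_routing M x i k = 1.
Proof.
rewrite /settled_routing (exchange_big_dep xpredT) //=.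
transitivity (\sum_m routing M i m).
  by apply: eq_bigr => m _; rewrite (big_pred1 (settle M x m)).
have delta (w : warehouse J) : \sum_v (w == v)%:R = 1 :> R.
  by rewrite (bigD1 w) //= eqxx big1 ?addr0 // => v /negPf; rewrite eq_sym => ->.
by rewrite big_node; case: i => [[w|]|w|w] /=;
   rewrite ?delta ?sum_weight ?big1_eq ?addr0 ?add0r.
Qed.

(** Traffic equations: the flow is first computed for the unsettled routing ([inflow]), then pushed
    forward along [settle]. *)
Lemma visit_routing k :
  \sum_i visit i * settled_routing M x i k = visit k.
Proof.
pose inflow m := \sum_i visit i * routing M i m.
have inflowE m : inflow m = match m with
    | Station None => \sum_w visit (Inbound w)
    | Station (Some w) => visit (Outbound w)
    | Outbound w | Inbound w => weight M w
    end.
  have pick (F : warehouse J -> R) w : \sum_v F v * (v == w)%:R = F w.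
    rewrite (bigD1 w) //= eqxx mulr1 big1 ?addr0 // => v /negPf->.
    by rewrite mulr0.
  have none (F : warehouse J -> R) : \sum_v F v * 0 = 0 by rewrite -mulr_suml mulr0.
  rewrite /inflow big_node; case: m => [[w|]|w|w] /=;
    rewrite ?pick ?none ?mulr0 ?mul1r ?addr0 ?add0r //.
  by apply: eq_bigr => v _; rewrite mulr1.
transitivity (\sum_(m | settle M x m == k) inflow m).
  rewrite /inflow exchange_big /=; apply: eq_bigr => i _.
  by rewrite /settled_routing mulr_sumr.
rewrite big_mkcond big_node /=.
under eq_bigr do rewrite inflowE.
under [X in _ + (X + _)]eq_bigr do rewrite inflowE.
under [X in _ + (_ + X)]eq_bigr do rewrite inflowE.
rewrite inflowE.
(* Except at the production center, a node receives flow on behalf of a single warehouse. *)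
have single w (P : pred (warehouse J)) (F : warehouse J -> R) :
    (forall i, P i -> i = w) ->
    \sum_i (if P i then F i else 0) = if P w then F w else 0.
  move=> Pw; rewrite -big_mkcond; case: ifPn => [Pw1|nPw].
    by apply: big_pred1 => i; apply/idP/eqP => [/Pw|->].
  by apply: big_pred0 => i; apply: contraNF nPw => Pi; rewrite -(Pw i Pi).
case: k => [[w|]|w|w] /=.
- rewrite !(single w) => [|i|i|i]; try by do ?case: ifP => _; move/eqP => // -[].
  by rewrite eqxx; case: ifP => _; rewrite ?eqxx /= ?addr0 ?add0r.
(* Each warehouse returns its weight to the center in exactly one way: through its inbound node, or
   directly when the distance is 0. *)
- rewrite big1_eq addr0 -big_split -[RHS]sum_weight -big_split; apply: eq_bigr => i _ /=.
  by case: ifP => _; rewrite ?eqxx /= ?addr0 ?add0r.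
- rewrite !(single w) => [|i|i]; try by do ?case: ifP => _; move/eqP => // -[].
  by case: (wdist M w x == 0); rewrite ?eqxx /= big1_eq ?addr0 ?add0r.
- rewrite !(single w) => [|i|i]; try by do ?case: ifP => _; move/eqP => // -[].
  by case: (wdist M w x == 0); rewrite ?eqxx /= big1_eq ?addr0 ?add0r.
Qed.

(* At a travel node of zero mean travel time the service rate n / 0 is 0, and
   [factor i n] is 0 for n >= 1, so such a node is empty under [product_form]. *)
Definition factor (i : node J) (n : nat) : R :=
  \prod_(k < n) (visit i / service_rate M x i k.+1).

Lemma service_rate0 i : service_rate M x i 0 = 0.
Proof. by case: i => [k|w|w] /=; rewrite ?mul0r // /station_rate min0n mulr0. Qed.

Lemma service_rate_ge0 i n : 0 <= service_rate M x i n.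
Proof.
case: i => [k|w|w] /=; rewrite ?divr_ge0 ?dist_ge0 //.
by rewrite mulr_ge0 // ltW.
Qed.

Lemma service_rateS_gt0 i n : visit i != 0 -> 0 < service_rate M x i n.+1.
Proof.
have travel w : (if wdist M w x == 0 then 0 else weight M w) != 0 ->
    0 < n.+1%:R / wdist M w x.
  have [_|d_neq0 _] := eqVneq (wdist M w x) 0; first by rewrite eqxx.
  by rewrite divr_gt0 // lt0r d_neq0 dist_ge0.
case: i => [k|w|w] //=; try exact: travel.
by move=> _; rewrite mulr_gt0 // ltr0n leq_min servers_ge1.
Qed.

(** Where [visit i] is 0 both sides vanish, so a zero service rate in the denominator does no
    harm. *)
Lemma factorS i n :
  factor i n.+1 * service_rate M x i n.+1 = visit i * factor i n.
Proof.
rewrite /factor big_ord_recr /= mulrC [RHS]mulrC mulrCA; congr (_ * _).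
have [->|v_neq0] := eqVneq (visit i) 0; first by rewrite mul0r mulr0.
by rewrite mulrC divfK // gt_eqF // service_rateS_gt0.
Qed.

Lemma factor_ge0 i n : 0 <= factor i n.
Proof. by apply: prodr_ge0 => k _; rewrite divr_ge0 ?visit_ge0 ?service_rate_ge0. Qed.

Section Chain.
Variable N : nat.
Implicit Types (n m : state J N).

Definition product_form n : R := \prod_i factor i (queue n i).

Lemma product_form_service n i : (0 < queue n i)%N ->
  product_form n * service_rate M x i (queue n i) =
  visit i * \prod_l factor l (queue n l - (l == i))%N.
Proof.
move=> n_gt0; rewrite /product_form (bigD1 i) // mulrAC [in RHS](bigD1 i) //=.
rewrite eqxx mulrA subn1 -factorS prednK //; congr (_ * _).
by apply: eq_bigr => l /negPf ->; rewrite subn0.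
Qed.

(** Without the moving truck, m and n are the same configuration; hence the inflow depends on the
    origin i only through [visit i]. *)
Lemma product_form_inflow i k n m : jump i k m n ->
  product_form m * service_rate M x i (queue m i) =
  visit i * \prod_l factor l (queue n l - (l == k))%N.
Proof.
case/jumpP => m_gt0 mn; rewrite product_form_service //; congr (_ * _).
by apply: eq_bigr => l _; rewrite mn addnK.
Qed.

(** Partial balance: for each node k, the flow into n by arrivals at k equals the flow out of n by
    departures from k, by the traffic equations. *)
Lemma product_form_balance n :
  \sum_m product_form m * transition_rate M x m n =
  product_form n * \sum_m transition_rate M x n m.
Proof.
have -> : \sum_m product_form m * transition_rate M x m n =
    \sum_k product_form n * service_rate M x k (queue n k).
  pose W k := \prod_l factor l (queue n l - (l == k))%N.
  transitivity (\sum_i \sum_k \sum_(m | jump i k m n)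
      visit i * settled_routing M x i k * W k).
    under eq_bigr do rewrite mulr_sumr.
    rewrite exchange_big; apply: eq_bigr => i _ /=.
    under eq_bigr do rewrite mulr_sumr big_mkcond.
    rewrite exchange_big; apply: eq_bigr => k _ /=; rewrite -big_mkcond.
    apply: eq_bigr => m mn; rewrite mulrA (product_form_inflow mn) /W.
    by ring.
  rewrite exchange_big; apply: eq_bigr => k _ /=.
  under eq_bigr => i _.
    under eq_bigl => m do rewrite jumpC.
    rewrite (@sum_jump _ _ _ k i n _ (visit i * settled_routing M x i k * W k)) //.
    over.
  (* An empty node k has just received no truck and serves none. *)
  have [n_eq0|n_gt0] := posnP (queue n k).
    by rewrite n_eq0 service_rate0 mulr0 big1.
  by rewrite -mulr_suml visit_routing product_form_service.
rewrite -mulr_sumr; congr (_ * _).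
rewrite exchange_big; apply: eq_bigr => i _ /=.
under eq_bigr do rewrite big_mkcond.
rewrite exchange_big /=.
under eq_bigr => k _.
  rewrite -big_mkcond.
  rewrite (@sum_jump _ _ _ i k n _
    (service_rate M x i (queue n i) * settled_routing M x i k)) //.
  over.
have [n_eq0|n_gt0] := posnP (queue n i).
  by rewrite n_eq0 service_rate0 big1.
by rewrite -mulr_sumr sum_settled_routing mulr1.
Qed.

End Chain.

(** * Positivity of factors and of the routing along a tour *)

Lemma factor_eq0 i n : visit i = 0 -> (0 < n)%N -> factor i n = 0.
Proof. by case: n => // n v0 _; rewrite /factor big_ord_recl v0 !mul0r. Qed.

Lemma factor_gt0 i n : visit i != 0 -> 0 < factor i n.
Proof.
move=> v_neq0; apply: prodr_gt0 => k _.
by rewrite divr_gt0 ?service_rateS_gt0 // lt0r v_neq0 visit_ge0.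
Qed.

Lemma routing_ge0 i k : 0 <= routing M i k.
Proof. by case: i k => [[w|]|w|w] [[v|]|v|v] //=; exact/ltW/weight_gt0. Qed.

Lemma le_settled_routing i m :
  routing M i m <= settled_routing M x i (settle M x m).
Proof.
rewrite /settled_routing (bigD1 m) //= lerDl sumr_ge0 // => l _.
exact: routing_ge0.
Qed.

Lemma settled_routing_ge0 i k : 0 <= settled_routing M x i k.
Proof. by apply: sumr_ge0 => m _; exact: routing_ge0. Qed.

Definition depth (i : node J) : nat :=
  match i with
  | Station None => 0
  | Outbound _ => 1
  | Station (Some _) => 2
  | Inbound _ => 3
  end.

(** One step back along the tour center, outbound, warehouse, inbound, skipping an outbound node of
    zero travel time. *)
Lemma upstream k : visit k != 0 -> k != Station None ->
  exists i, [/\ visit i != 0, (depth i < depth k)%N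
              & 0 < settled_routing M x i k].
Proof.
have w_neq0 w : weight M w != 0 by rewrite gt_eqF ?weight_gt0.
have one : (1 : R) != 0 by rewrite oner_eq0.
have lt_one i m : routing M i m = 1 -> 0 < settled_routing M x i (settle M x m).
  by move=> r1; apply: lt_le_trans (le_settled_routing i m); rewrite r1.
have lt_w w : 0 < settled_routing M x (Station None) (settle M x (Outbound w)).
  by apply: lt_le_trans (le_settled_routing _ _); rewrite /= weight_gt0.
case: k => [[w|]|w|w] /= v_neq0 k_neq //.
- have [d0|d_neq0] := eqVneq (wdist M w x) 0.
    by exists (Station None); split=> //; have := lt_w w; rewrite /= d0 eqxx.
  exists (Outbound w); split=> //=; first by rewrite (negPf d_neq0).
  by apply: (lt_one _ (Station (Some w))); rewrite /= eqxx.
- exists (Station None); split=> //=; have := lt_w w; rewrite /=.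
  by case: ifP v_neq0; rewrite ?eqxx.
- exists (Station (Some w)); split=> //=.
  have := lt_one (Station (Some w)) (Inbound w); rewrite /= eqxx.
  by case: ifP v_neq0 => [|_ _ ->]; rewrite ?eqxx.
Qed.

(** * Uniqueness of the equilibrium *)

Section Uniqueness.
Variable N : nat.
Implicit Types (n m : state J N) (p : state J N -> R).

Lemma admissibleP n :
  admissible M x n <-> forall i, (0 < queue n i)%N -> visit i != 0.
Proof.
split=> [n_adm [[w|]|w|w] //= n_gt0|n_vis w d0].
- by rewrite gt_eqF ?weight_gt0.
- have [d0|_] := eqVneq (wdist M w x) 0; last by rewrite gt_eqF ?weight_gt0.
  by have [n0 _] := n_adm w d0; rewrite n0 in n_gt0.
- have [d0|_] := eqVneq (wdist M w x) 0; last by rewrite gt_eqF ?weight_gt0.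
  by have [_ n0] := n_adm w d0; rewrite n0 in n_gt0.
- have := n_vis (Inbound w); have := n_vis (Outbound w); rewrite /= d0 eqxx.
  by case: (queue n _) => [|k]; case: (queue n _) => [|l] //; rewrite eqxx => a b;
    [have := b isT|have := a isT|have := a isT].
Qed.

Lemma product_form_gt0 n : admissible M x n -> 0 < product_form n.
Proof.
move=> /admissibleP n_vis; apply: prodr_gt0 => i _.
have [->|n_gt0] := posnP (queue n i); first by rewrite /factor big_ord0.
by rewrite factor_gt0 ?n_vis.
Qed.

Lemma product_form_eq0 n : ~ admissible M x n -> product_form n = 0.
Proof.
move=> n_nadm; apply/eqP; apply: contra_notT n_nadm => pn_neq0.
apply/admissibleP => i n_gt0; apply: contra pn_neq0 => /eqP v0.
by rewrite /product_form (bigD1 i) //= factor_eq0 ?mul0r.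
Qed.

Lemma product_form_ge0 n : 0 <= product_form n.
Proof. by apply: prodr_ge0 => i _; exact: factor_ge0. Qed.

Lemma transition_rate_ge0 n m : 0 <= transition_rate M x n m.
Proof.
apply: sumr_ge0 => i _; apply: sumr_ge0 => k _.
by rewrite mulr_ge0 ?settled_routing_ge0 ?service_rate_ge0.
Qed.

Lemma transition_rate_gt0 i k n m : jump i k n m -> visit i != 0 ->
  0 < settled_routing M x i k -> 0 < transition_rate M x n m.
Proof.
move=> nm v_neq0 r_gt0; have [n_gt0 _] := jumpP _ _ _ _ nm.
rewrite /transition_rate (bigD1 i) //= (bigD1 k) //= -addrA ltr_pwDl //.
  by rewrite mulr_gt0 // -(prednK n_gt0) service_rateS_gt0.
have term_ge0 i' k' :
    0 <= service_rate M x i' (queue n i') * settled_routing M x i' k'.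
  by rewrite mulr_ge0 ?settled_routing_ge0 ?service_rate_ge0.
rewrite addr_ge0 ?sumr_ge0 // => i' _.
by rewrite sumr_ge0.
Qed.

(** Neither sign nor normalisation is imposed, so that differences and opposites of balanced
    functions qualify. *)
Definition balanced p : Prop := forall n, admissible M x n ->
  \sum_m p m * transition_rate M x m n = p n * \sum_m transition_rate M x n m.

(** All trucks at the production center: a state admissible for every location, at which balanced
    functions are compared. *)
Variable (home : state J N).
Hypothesis homeE : forall i, i != Station None -> queue home i = 0%N.

Lemma home_admissible : admissible M x home.
Proof. by move=> w _; rewrite !homeE. Qed.

(* A zero of a nonnegative balanced function spreads to all predecessors, and
   every state other than home has a predecessor with one truck less advanced
   on its tour. *)
Lemma balanced_eq0 p n : (forall m, 0 <= p m) -> balanced p ->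
  admissible M x n -> p n = 0 -> p home = 0.
Proof.
move=> p_ge0 p_bal; pose height m := (\sum_i depth i * queue m i)%N.
have [h] := ubnP (height n); elim: h n => // h IH n; rewrite ltnS => n_h n_adm pn0.
have [k_ex|n_home] := pselect (exists2 k, k != Station None & (0 < queue n k)%N).
  have [k k_neq n_gt0] := k_ex.
  have /admissibleP n_vis := n_adm.
  have [i [v_neq0 lt_ik r_gt0]] := upstream (n_vis k n_gt0) k_neq.
  have [m nm] := jump_ex i n_gt0; have [_ mE] := jumpP _ _ _ _ nm.
  apply: (IH m).
  - apply: leq_trans n_h; rewrite /height.
    (* Moving a truck back from k to i changes an [f]-weighted truck count by f i - f k; for [depth]
       this is a strict decrease. *)
    have moveE (f : node J -> nat) :
        (\sum_l f l * queue m l + f k = \sum_l f l * queue n l + f i)%N.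
      have fE j : f j = (\sum_l f l * (l == j))%N.
        by rewrite (bigD1 j) //= eqxx muln1 big1 ?addn0 // => l /negPf ->; rewrite muln0.
      rewrite [in LHS](fE k) [in RHS](fE i) -!big_split /=; apply: eq_bigr => l _.
      rewrite -!mulnDr mE; congr (_ * _)%N.
      by rewrite addnAC; case: eqP => [->|_]; rewrite ?subnK // subn0 addn0.
    by have := moveE depth; lia.
  - apply/admissibleP => l; rewrite mE; case: (eqVneq l i) => [->//|_].
    by rewrite addn0 => lt0; apply: n_vis; lia.
  (* The total inflow into n is 0 and its terms are nonnegative, so each vanishes; the rate from m
     to n is positive, which forces p m = 0. *)
  have /eqP := p_bal n n_adm; rewrite pn0 mul0r psumr_eq0; last first.
    by move=> l _; rewrite mulr_ge0 ?transition_rate_ge0.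
  move=> /allP /(_ m (mem_index_enum _)); rewrite implyTb mulf_eq0 => /orP[/eqP//|].
  by rewrite gt_eqF // (@transition_rate_gt0 i k) // jumpC.
rewrite -pn0; congr p; apply: queue_inj => i.
have n0 j : j != Station None -> queue n j = 0%N.
  move=> j_neq; apply/eqP; rewrite -leqn0 leqNgt; apply/negP => n_gt0.
  by apply: n_home; exists j.
have [->|i_neq] := eqVneq i (Station None); last by rewrite homeE ?n0.
have centerE m : (forall j, j != Station None -> queue m j = 0%N) ->
    queue m (Station None) = N.
  move=> m0; rewrite -[RHS](sum_queue m) [RHS](bigD1 (Station None)) //=.
  by rewrite big1 ?addn0.
by rewrite !centerE.
Qed.

(* Maximum principle for p / product_form. *)
Lemma balanced_le p n : balanced p ->
    (forall m, ~ admissible M x m -> p m = 0) ->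
  p n * product_form home <= p home * product_form n.
Proof.
move=> p_bal p_adm.
pose adm m := `[< admissible M x m >].
have home_adm : adm home by apply/asboolP; exact: home_admissible.
case: (@Order.TotalTheory.arg_maxP _ R _ home adm (fun m => p m / product_form m)
  home_adm) => n0 /asboolP n0_adm n0_max.
set c := p n0 / _ in n0_max.
(* With [c] the maximal ratio, [v] is nonnegative, balanced and zero at the maximiser [n0], hence
   zero at [home]: the maximum is attained there too. *)
pose v m := c * product_form m - p m.
have v_ge0 m : 0 <= v m.
  rewrite subr_ge0; have [m_adm|m_nadm] := pselect (admissible M x m).
    by rewrite -ler_pdivrMr ?product_form_gt0 //; apply: n0_max; apply/asboolP.
  by rewrite p_adm // product_form_eq0 // mulr0.
have v_bal : balanced v.
  move=> m m_adm; rewrite mulrBl -mulrA -product_form_balance -p_bal //.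
  rewrite mulr_sumr -sumrB; apply: eq_bigr => l _.
  by rewrite mulrBl mulrA.
have v0 : v n0 = 0 by rewrite /v divfK ?subrr // gt_eqF // product_form_gt0.
have /eqP := balanced_eq0 v_ge0 v_bal n0_adm v0; rewrite subr_eq0 => /eqP <-.
rewrite mulrAC ler_wpM2r ?product_form_ge0 //.
by have := v_ge0 n; rewrite subr_ge0.
Qed.

Definition total_mass : R := \sum_(n : state J N) product_form n.

Lemma total_mass_gt0 : 0 < total_mass.
Proof.
rewrite /total_mass (bigD1 home) //= ltr_pwDl ?product_form_gt0 //.
  exact: home_admissible.
by apply: sumr_ge0 => n _; exact: product_form_ge0.
Qed.

Lemma stationary_product_form :
  stationary M x [ffun n : state J N => product_form n / total_mass].
Proof.
split=> [n||n n_nadm|n _].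
- by rewrite ffunE divr_ge0 ?product_form_ge0 // ltW // total_mass_gt0.
- under eq_bigr do rewrite ffunE.
  by rewrite -mulr_suml divff // gt_eqF // total_mass_gt0.
- by rewrite ffunE product_form_eq0 // mul0r.
rewrite ffunE mulrAC -product_form_balance mulr_suml.
by apply: eq_bigr => m _; rewrite ffunE mulrAC.
Qed.

(** The maximum principle applied to p and to -p makes p proportional to [product_form]; total mass
    1 fixes the constant. *)
Lemma stationaryE (p : {ffun state J N -> R}) n :
  stationary M x p -> p n = product_form n / total_mass.
Proof.
case=> p_ge0 p_sum p_adm p_bal.
have home_gt0 := product_form_gt0 home_admissible.
have pE m : p m * product_form home = p home * product_form m.
  apply/eqP; rewrite eq_le balanced_le //=.
  rewrite -lerN2 -!mulNr; apply: (@balanced_le (fun m => - p m)).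
    move=> l l_adm; rewrite mulNr -p_bal // -sumrN.
    by apply: eq_bigr => j _; rewrite mulNr.
  by move=> l /p_adm ->; rewrite oppr0.
have homeZ : product_form home = p home * total_mass.
  by rewrite mulr_sumr -[LHS]mul1r -p_sum mulr_suml; apply: eq_bigr.
have Z_neq0 : total_mass != 0 by rewrite gt_eqF // total_mass_gt0.
apply: (mulIf (lt0r_neq0 home_gt0)); rewrite pE homeZ.
by rewrite [RHS]mulrCA divfK.
Qed.

Lemma stationary_distributionE n :
  stationary_distribution M N x n = product_form n / total_mass.
Proof.
apply: stationaryE; apply: xgetPex.
by exists [ffun n : state J N => product_form n / total_mass]; exact: stationary_product_form.
Qed.

End Uniqueness.

(** * Throughput *)

Definition node_poly (K : nat) (i : node J) : {poly R} :=
  \poly_(n < K) factor i n.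

Lemma total_massE N : total_mass N = (\prod_i node_poly N.+1 i)`_N.
Proof. exact: sum_prod_queue. Qed.

(** By [factorS], weighting the factors of warehouse w by its service rate multiplies its generating
    polynomial by the weight and by 'X, which lowers the degree to be read off by one. *)
Lemma sum_product_form_station N w :
  \sum_(n : state J N.+1) product_form n *
     station_rate M (Some w) (queue n (Station (Some w))) =
  weight M w * (\prod_i node_poly N.+2 i)`_N.
Proof.
pose g i n :=
  factor i n * (if i == Station (Some w) then station_rate M (Some w) n else 1).
transitivity (\sum_(n : state J N.+1) \prod_i g i (queue n i)).
  apply: eq_bigr => n _; rewrite big_split /=; congr (_ * _).
  by rewrite (bigD1 (Station (Some w))) //= eqxx big1 ?mulr1 // => i /negPf ->.
rewrite sum_prod_queue (bigD1 (Station (Some w))) //=.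
have gw : eq_upto N.+1 (\poly_(k < N.+2) g (Station (Some w)) k)
    (weight M w *: (node_poly N.+2 (Station (Some w)) * 'X)).
  move=> k le_k; rewrite coefZ coefMX !coef_poly ltnS le_k /g eqxx.
  case: k le_k => [|k] le_k /=.
    by rewrite [station_rate _ _ _](service_rate0 (Station (Some w))) !mulr0.
  by rewrite ltnS ltnW // [LHS](factorS (Station (Some w))).
have gi : \prod_(i | i != Station (Some w)) \poly_(k < N.+2) g i k =
    \prod_(i | i != Station (Some w)) node_poly N.+2 i.
  apply: eq_bigr => i /negPf i_neq.
  by apply/polyP => l; rewrite !coef_poly /g i_neq mulr1.
rewrite gi (eq_uptoM gw (fun _ _ => erefl)) // -scalerAl coefZ.
rewrite [_ * 'X * _]mulrAC coefMX /=.
by rewrite [in RHS](bigD1 (Station (Some w))).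
Qed.

Lemma home_ex N : exists home : state J N,
  forall i, i != Station None -> queue home i = 0%N.
Proof.
have [|home homeE] := @state_of J N (fun i => if i == Station None then N else 0%N).
  by rewrite (bigD1 (Station None)) //= big1 ?addn0 // => i /negPf ->.
by exists home => i /negPf i_neq; rewrite homeE i_neq.
Qed.

(** Each warehouse contributes its weight times the same ratio, and the weights sum to 1. *)
Lemma warehouse_throughputE N : warehouse_throughput M N.+1 x =
  (\prod_i node_poly N.+2 i)`_N / (\prod_i node_poly N.+2 i)`_N.+1.
Proof.
have [home homeE] := home_ex N.+1.
rewrite /warehouse_throughput -total_massE -[X in X / _]mul1r -sum_weight.
rewrite !mulr_suml; apply: eq_bigr => w _.
rewrite -sum_product_form_station mulr_suml; apply: eq_bigr => n _.
by rewrite (stationary_distributionE homeE) mulrAC.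
Qed.

Lemma node_poly_station_log_concave K k : log_concave (node_poly K (Station k)).
Proof.
pose g n := visit (Station k) / service_rate M x (Station k) n.+1.
apply: (@log_concave_poly _ g) => [n|n n' le_n]; rewrite /g.
  by rewrite divr_ge0 ?visit_ge0 ?service_rate_ge0.
rewrite ler_wpM2l ?visit_ge0 // lef_pV2 ?posrE; last 2 first.
- by rewrite mulr_gt0 // ltr0n leq_min servers_ge1.
- by rewrite mulr_gt0 // ltr0n leq_min servers_ge1.
apply: ler_wpM2l; [exact: ltW|rewrite ler_nat].
by rewrite leq_min geq_minr geq_min ltnS le_n.
Qed.

Lemma node_poly_nneg K i : node_poly K i \is a polyOver Num.nneg.
Proof. by apply: polyOver_poly => n _; rewrite nnegrE factor_ge0. Qed.

Lemma node_poly_travel K w :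
  (node_poly K (Outbound w) = expansion K (weight M w * wdist M w x)) *
  (node_poly K (Inbound w) = expansion K (weight M w * wdist M w x)).
Proof.
have E n : \prod_(k < n) ((if wdist M w x == 0 then 0 else weight M w) /
      (k.+1%:R / wdist M w x)) =
    \prod_(k < n) (weight M w * wdist M w x / k.+1%:R).
  (* At distance 0 both ratios are 0: on the left through [visit], on the right through the load. *)
  apply: eq_bigr => k _; have [->|_] := eqVneq (wdist M w x) 0.
    by rewrite mulr0 !mul0r.
  by rewrite invf_div mulrA.
by split; apply/polyP => n; rewrite !coef_poly; case: ifP => // _; exact: E.
Qed.

(** The loads of the outbound nodes add up to the Weber objective, and so do those of the inbound
    nodes. *)
Lemma node_poly_prod N : eq_upto N (\prod_i node_poly N.+1 i)
  (expansion N.+1 (weber M x + weber M x) *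
   \prod_k node_poly N.+1 (Station k)).
Proof.
have -> : \prod_i node_poly N.+1 i =
    (\prod_w expansion N.+1 (weight M w * wdist M w x) *
     \prod_w expansion N.+1 (weight M w * wdist M w x)) *
    \prod_k node_poly N.+1 (Station k).
  rewrite big_node [in RHS]big_option mulrC; congr (_ * _).
  by congr (_ * _); apply: eq_bigr => w _; rewrite node_poly_travel.
apply: eq_uptoM => // k le_k; rewrite -expansionD //.
by apply: eq_uptoM le_k; exact: expansion_sum.
Qed.

Lemma weber_ge0 : 0 <= weber M x.
Proof. by apply: sumr_ge0 => w _; rewrite mulr_ge0 ?dist_ge0 // ltW ?weight_gt0. Qed.

End Equilibrium.

Theorem theorem4p4 (R : realType) (J : nat) (J_ge2 : (2 <= J)%N)
    (M : network R J)
    (demand_gt0 : forall w, 0 < demand M w)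
    (dist_ge0 : forall z, 0 <= dist M z)
    (dist_convex : convex_function
       [set: convex_lmodType ('rV[R]_2 * 'rV[R]_2)%type] (dist M))
    (servers_ge1 : forall k, (1 <= servers M k)%N)
    (rate_gt0 : forall k, 0 < rate M k)
    (xstar : plane R) (xstar_weber : weber_solution M xstar) :
  forall N : nat, (1 <= N)%N ->
  forall x : plane R,
    warehouse_throughput M N x <= warehouse_throughput M N xstar.
Proof.
case=> // N _ x.
have posG y : 0 < (\prod_i node_poly M y N.+2 i)`_N.+1.
  have [home homeE] := home_ex J N.+1.
  by rewrite -total_massE; exact: (total_mass_gt0 y J_ge2 _ _ _ _ homeE).
rewrite !warehouse_throughputE //.
rewrite ler_pdivrMr ?posG // mulrAC ler_pdivlMr ?posG //.
rewrite !node_poly_prod //.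
set a := weber M xstar; set b := weber M x - a.
have b_ge0 : 0 <= b by rewrite subr_ge0 xstar_weber.
have a_ge0 : 0 <= a by exact: weber_ge0.
have -> : weber M x + weber M x = (b + b) + (a + a) by rewrite /b; ring.
(* The station polynomials are convertible for [x] and [xstar], so [S] serves both locations. *)
set S := \prod_k node_poly M x N.+2 (Station k).
have EDS : eq_upto N.+1 (expansion N.+2 (b + b) * (expansion N.+2 (a + a) * S))
    (expansion N.+2 ((b + b) + (a + a)) * S).
  by rewrite mulrA; apply: eq_uptoM => //; exact: expansionD.
(* The series at [x] is the one at [xstar] times exp(2 b t), where b is the excess of the Weber
   objective. *)
rewrite -!EDS //; apply: coef_ratio_mul.
- apply: log_concaveM; first by apply: log_concave_expansion; rewrite addr_ge0.
  by apply: log_concave_prod => k; exact: node_poly_station_log_concave.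
- apply: polyOver_mulr_2closed; first by apply: expansion_nneg; rewrite addr_ge0.
  apply: (big_ind (fun p => p \is a polyOver Num.nneg)) => [|p q|k _].
  + exact: polyOver_mul1_closed.
  + exact: polyOver_mulr_2closed.
  + exact: node_poly_nneg.
- by apply: expansion_nneg; rewrite addr_ge0.
Qed.
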